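(* Let $m\le n$. The following spaces are totally geodesic subspaces of $M_+(n,m)$ with respect to the Riemannian metric $\langle u,v\rangle_a=\operatorname{tr}(u(a^Ta)^{-1}v^T)\sqrt{\det(a^Ta)}$: (1) the space $\operatorname{Scal}(b):=\{\lambda b\mid\lambda\in\mathbb R_{>0}\}$, where $b$ is any fixed element of $M_+(n,m)$; (2) the space $\operatorname{GL}(m)$, where elements of $\operatorname{GL}(m)$ are extended to $n\times m$ matrices by zeros.
   Context: $M_+(n,m)$ is the set of real $n\times m$ matrices of rank $m$, an open subset of the space of all real $n\times m$ matrices. $\operatorname{GL}(m)$ is the group of invertible real $m\times m$ matrices, embedded via $c\mapsto\begin{pmatrix}c\\0_{(n-m)\times m}\end{pmatrix}$. *)

(* Defs.v *)
From HB Require Import structures.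
From mathcomp Require Import all_boot all_order all_algebra.
From mathcomp Require Import all_classical all_reals all_analysis.

Set Implicit Arguments.
Unset Strict Implicit.
Unset Printing Implicit Defensive.

Import Order.TTheory GRing.Theory Num.Theory.
Import numFieldNormedType.Exports.

Local Open Scope classical_set_scope.
Local Open Scope ring_scope.

Section RiemannianGeometry.
Variable R : realType.

(* [metric E] is the raw data of a Riemannian metric on an open subset of the
   vector space [E], whose tangent spaces are all identified with [E]:
   [g x u v] is the inner product of [u] and [v] at [x]. *)
Definition metric (E : normedModType R) := E -> E -> E -> R.

(* C^k maps on an open set.  For finite-dimensional [F], a map is C^(k+1) iff
   it is differentiable and all its directional derivatives are C^k. *)
Fixpoint Ck (F E : normedModType R) (k : nat) (V : set F) (f : F -> E) : Prop :=
  match k with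
  | 0 => forall x, V x -> {for x, continuous f}
  | k'.+1 => (forall x, V x -> differentiable f x) /\
             (forall v, Ck k' V (fun x => 'D_v f x))
  end.

Definition smooth (F E : normedModType R) (V : set F) (f : F -> E) : Prop :=
  forall k, Ck k V f.

(* [levi_civita g x u v z] states that [z] is the Levi-Civita covariant
   derivative at [x] of the constant vector field [v] in the direction [u],
   i.e. the value Gamma_x(u, v) of the Christoffel symbols.  It is Koszul's
   formula; the Lie bracket terms vanish since the fields are constant. *)
Definition levi_civita (E : normedModType R) (g : metric E) (x u v z : E) :=
  forall w, 2 * g x z w =
    'D_u (fun y => g y v w) x + 'D_v (fun y => g y u w) x
    - 'D_w (fun y => g y u v) x.

(* Geodesics of [(U, g)], [U] open in [E], on the open time interval [I]:
   c'' + Gamma_c(c', c') = 0. *)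
Definition geodesic (E : normedModType R) (U : set E) (g : metric E)
    (I : set R) (c : R -> E) : Prop :=
  [/\ open I, is_interval I &
    forall t, I t ->
      [/\ U (c t), derivable c t 1, derivable (derive1 c) t 1 &
          levi_civita g (c t) (derive1 c t) (derive1 c t)
            (- derive1 (derive1 c) t)]].

(* [(V, phi)] is a (local) parametrization, i.e. an inverse chart, of the
   embedded [d]-dimensional submanifold [N] of [E].  The last clause says that
   [phi] is an open map into [N] with its subspace topology; hence [phi @` V]
   is relatively open in [N] and [phi] is a homeomorphism onto it. *)
Definition parametrization (E : normedModType R) (N : set E) (d : nat)
    (V : set 'rV[R]_d) (phi : 'rV[R]_d -> E) : Prop :=
  [/\ open V, smooth V phi,
      (forall x y, V x -> V y -> phi x = phi y -> x = y),
      (forall x, V x -> injective (fun u => 'D_u phi x)) &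
      (forall O : set 'rV[R]_d, open O -> O `<=` V ->
         exists2 W : set E, open W & phi @` O = N `&` W)].

Definition submanifold (E : normedModType R) (N : set E) : Prop :=
  exists d : nat, forall p, N p ->
    exists (V : set 'rV[R]_d) (phi : 'rV[R]_d -> E),
      parametrization N V phi /\ (phi @` V) p.

(* Coordinate expression of the metric induced by [g] on a submanifold. *)
Definition pullback (F E : normedModType R) (phi : F -> E) (g : metric E)
  : metric F := fun x u v => g (phi x) ('D_u phi x) ('D_v phi x).

(* Geodesics of the submanifold [N] for the metric induced by [g]: every
   expression of the curve in local coordinates of [N] is a geodesic of the
   induced metric in these coordinates. *)
Definition induced_geodesic (E : normedModType R) (N : set E) (g : metric E)
    (I : set R) (c : R -> E) : Prop :=
  [/\ open I, is_interval I,
      (forall t, I t -> N (c t) /\ {for t, continuous c}) &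
    forall (d : nat) (V : set 'rV[R]_d) (phi : 'rV[R]_d -> E),
      parametrization N V phi ->
      forall (J : set R) (x : R -> 'rV[R]_d),
        open J -> is_interval J -> J `<=` I ->
        (forall t, J t -> V (x t) /\ phi (x t) = c t) ->
        geodesic V (pullback phi g) J x].

(* [N] is a totally geodesic subspace of [(M, g)], [M] open in [E]: it is an
   embedded submanifold whose geodesics for the induced metric are geodesics
   of [(M, g)]. *)
Definition totally_geodesic (E : normedModType R) (M : set E) (g : metric E)
    (N : set E) : Prop :=
  [/\ N `<=` M, submanifold N &
      forall I c, induced_geodesic N g I c -> geodesic M g I c].

End RiemannianGeometry.

Section FullRankMatrices.
Variable R : realType.

Definition Mplus (n m : nat) : set 'M[R]_(n, m) := [set a | \rank a = m].

Definition mx_metric (n m : nat) : metric 'M[R]_(n, m) := fun a u v =>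
  \tr (u *m invmx (a^T *m a) *m v^T) * Num.sqrt (\det (a^T *m a)).

Definition Scal (n m : nat) (b : 'M[R]_(n, m)) : set 'M[R]_(n, m) :=
  [set lambda *: b | lambda in [set lambda : R | 0 < lambda]].

Definition extend0 (n m : nat) (hmn : (m <= n)%N) (c : 'M[R]_m)
  : 'M[R]_(n, m) := castmx (subnKC hmn, erefl m) (col_mx c 0).

Definition GLm (n m : nat) (hmn : (m <= n)%N) : set 'M[R]_(n, m) :=
  [set extend0 hmn c | c in [set c : 'M[R]_m | c \in unitmx]].

End FullRankMatrices.

(* Main.v *)
Require Import Defs.
From mathcomp Require Import all_boot all_order all_fingroup all_algebra.
From mathcomp Require Import all_classical all_reals all_analysis.
From mathcomp Require Import ring lra.

(** Both submanifolds are open pieces of linear subspaces: there is a linear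
injection [phi] of a coordinate space and an open [V] with [N = phi @` V], and
[phi] has a linear left inverse [psi].  Hence one chart is global, a curve in
[N] is read in it as [psi \o c], and the geodesic equation of the induced metric
says that Koszul's formula for [- c''] holds when tested against the vectors
tangent to [N].  A geodesic of [Mplus] requires the formula against all vectors,
so the only thing left is to test it against a complement of the tangent space;
this is the vanishing of the second fundamental form
([totally_geodesic_linear], [mx_totally_geodesic_linear]).

On [Mplus] the derivative of the metric in the direction [w] is explicit
([is_derive_mx_metric]).  With [G = a^T a], [A = G^-1] and
[K = w^T a + a^T w] the derivative of [G], Jacobi's formula and the rule
[(G^-1)' = - A K A] give
[sqrt (det G) * (tr (K A) / 2 * tr (u A v^T) - tr (u A K A v^T))].
The square root can be differentiated because [det G > 0] at full rank
([gram_det_gt0]).  Every term of Koszul's formula therefore vanishes as soon as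
[w] satisfies the trace identities collected in [metric_normal].

- For [GL], write its elements as [J c] with [J^T J = 1].  A vector [w] minus its
  projection [J J^T w] is killed by [J^T], so all products [w^T a], [a^T w] with
  [a] in [GL] are zero.
- For [Scal b], subtract from [w] the multiple of [b] that makes
  [tr (b (b^T b)^-1 w^T)] zero.  On the ray of [b] the matrices [G], [A] and the
  derivative of [G] along [b] are multiples of [b^T b] and of its inverse, so
  each identity reduces to this one.  The multiple exists because
  [tr (b (b^T b)^-1 b^T) = m] is nonzero; for [m = 0] both spaces are the single
  point of the space of empty matrices. *)

Set Implicit Arguments.
Unset Strict Implicit.
Unset Printing Implicit Defensive.

Import Order.TTheory GRing.Theory Num.Theory.
Import numFieldNormedType.Exports.

Local Open Scope classical_set_scope.
Local Open Scope ring_scope.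

(** * Linear maps *)

Section LinearMaps.
Variable R : realType.

Lemma mx_linear_continuous p q (W : normedModType R)
  (f : {linear 'M[R]_(p, q) -> W}) : continuous f.
Proof.
have -> : (f : _ -> _) =
    \sum_(i < p) \sum_(j < q) (fun A : 'M[R]_(p, q) => A i j *: f (delta_mx i j)).
  apply/funext => A; rewrite {1}(matrix_sum_delta A) fct_sumE linear_sum.
  apply: eq_bigr => i _; rewrite fct_sumE linear_sum.
  by apply: eq_bigr => j _; rewrite linearZ.
apply: (big_ind (fun g : 'M[R]_(p, q) -> W => continuous g)) => [x|g h gc hc x|i _].
- exact: (@cst_continuous _ _ 0).
- exact: (cvgD (gc x) (hc x)).
apply: (big_ind (fun g : 'M[R]_(p, q) -> W => continuous g)) => [x|g h gc hc x|j _].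
- exact: (@cst_continuous _ _ 0).
- exact: (cvgD (gc x) (hc x)).
by move=> x; apply: cvgZr_tmp (@coord_continuous R p q i j x).
Qed.

Variables (F E : normedModType R) (f : {linear F -> E}).

(** The difference quotients on both sides are
the same function. *)
Lemma derive_comp_linear (W : normedModType R) (h : E -> W) x u :
  'D_u (h \o f) x = 'D_(f u) h (f x).
Proof.
rewrite /derive; congr (lim (_ @ 0^')).
by apply/funext => t /=; rewrite linearP.
Qed.

Hypothesis fc : continuous f.

Lemma derive_linear x u : 'D_u f x = f u.
Proof.
by rewrite deriveE ?diff_lin//; exact: linear_differentiable.
Qed.

Lemma is_derive_linear_comp (G : normedModType R) (c : G -> F) t v dc :
  is_derive t v c dc -> is_derive t v (f \o c) (f dc).
Proof.
move=> [cd <-].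
have H : (fun h : R => h^-1 *: (((f \o c) \o shift t) (h *: v) - (f \o c) t)) @ 0^'
    --> f ('D_v c t).
  rewrite [X in X @ _](_ : _ =
     f \o (fun h : R => h^-1 *: ((c \o shift t) (h *: v) - c t))); last first.
    by apply/funext => h /=; rewrite linearZZ (linearB f).
  by apply: (cvg_comp _ _ cd); exact: fc.
by split; [apply/cvg_ex; eexists; exact: H | exact: cvg_lim H].
Qed.

Lemma Ck_cst k (V : set F) (y : E) : Ck k V (cst y).
Proof.
elim: k y => [|k IH] y /=; first by move=> x _; exact: cvg_cst.
split=> [x _|v]; first exact: differentiable_cst.
rewrite (_ : (fun x => _) = cst 0) ?IH//.
by apply/funext => x; rewrite derive_cst.
Qed.

Lemma smooth_linear (V : set F) : smooth V f.
Proof.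
case=> [x _|k]; first exact: fc.
split=> [x _|v]; first exact: linear_differentiable.
rewrite (_ : (fun x => _) = cst (f v)); first exact: Ck_cst.
by apply/funext => x; rewrite derive_linear.
Qed.

End LinearMaps.

(** * Differential calculus of matrix-valued functions *)

Section MatrixCalculus.
Variables (R : realType) (V : normedModType R).
Implicit Types (x v : V).

Lemma is_derive_mxP p q (M : V -> 'M[R]_(p, q)) x v D :
  is_derive x v M D <-> forall i j, is_derive x v (fun y => M y i j) (D i j).
Proof.
split=> [[Md <-] i j|Md].
  have /derivable_mxP Mij := Md; split; first exact: Mij.
  by rewrite derive_mx// mxE.
have Md' : derivable M x v by apply/derivable_mxP => i j; case: (Md i j).
split => //; rewrite derive_mx//; apply/matrixP => i j; rewrite mxE.
by case: (Md i j).
Qed.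

(** A directional derivative is the ordinary derivative of the restriction to a
line, which gives access to the one-variable chain rule. *)
Lemma is_derive_lineP (W : normedModType R) (f : V -> W) x v D :
  is_derive x v f D <-> is_derive (0 : R) 1 (fun t : R => f (t *: v + x)) D.
Proof.
have e : 'D_1 (fun t : R => f (t *: v + x)) (0 : R) = 'D_v f x.
  rewrite /derive; congr (lim (_ @ 0^')).
  by apply/funext => t /=; rewrite addr0 scale0r add0r [_%:A]mulr1.
split=> [[fd <-]|[fd <-]].
  by split; [exact: (derivable1P f x v).1|exact: e].
by split; [exact: (derivable1P f x v).2|rewrite e].
Qed.

Lemma is_derive_comp_real (g : R -> R) (h : V -> R) x v dg dh :
  is_derive (h x) (1 : R) g dg -> is_derive x v h dh ->
  is_derive x v (g \o h) (dg * dh).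
Proof.
move=> gd /is_derive_lineP hd; apply/is_derive_lineP.
by apply: is_derive1_comp; rewrite scale0r add0r.
Qed.

Lemma is_derive_bigsum (I : Type) (r : seq I) (P : pred I) (W : normedModType R)
    (h : I -> V -> W) x v (dh : I -> W) :
  (forall i, P i -> is_derive x v (h i) (dh i)) ->
  is_derive x v (fun y => \sum_(i <- r | P i) h i y) (\sum_(i <- r | P i) dh i).
Proof.
move=> hd; rewrite -fct_sumE; elim/big_ind2 : _ => //.
  exact: is_derive_cst.
by move=> *; exact: is_deriveD.
Qed.

Lemma is_derive_mulr (f g : V -> R) x v df dg :
  is_derive x v f df -> is_derive x v g dg ->
  is_derive x v (fun y => f y * g y) (df * g x + f x * dg).
Proof.
move=> fd gd; have := is_deriveM fd gd.
by rewrite /GRing.scale/= addrC [g x * df]mulrC.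
Qed.

Lemma is_derive_mulmx p q r (M : V -> 'M[R]_(p, q)) (N : V -> 'M[R]_(q, r))
    x v dM dN :
  is_derive x v M dM -> is_derive x v N dN ->
  is_derive x v (fun y => M y *m N y) (dM *m N x + M x *m dN).
Proof.
move=> /is_derive_mxP Md /is_derive_mxP Nd; apply/is_derive_mxP => i j.
rewrite (_ : (fun y => _) = (fun y => \sum_k M y i k * N y k j)); last first.
  by apply/funext => y; rewrite mxE.
rewrite !mxE -big_split/=.
apply: is_derive_bigsum => k _.
exact: is_derive_mulr.
Qed.

Lemma is_derive_bigprod (I : eqType) (r : seq I) (h : I -> V -> R) x v (dh : I -> R) :
  uniq r ->
  (forall i, is_derive x v (h i) (dh i)) ->
  is_derive x v (fun y => \prod_(i <- r) h i y)
    (\sum_(i <- r) \prod_(j <- r) (if j == i then dh j else h j x)).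
Proof.
move=> + hd; elim: r => [_|i r IH /= /andP[ir ur]].
  rewrite big_nil (_ : (fun _ => _) = cst 1); first exact: is_derive_cst.
  by apply/funext => y; rewrite big_nil.
rewrite (_ : (fun _ => _) = (fun y => h i y * \prod_(i <- r) h i y)); last first.
  by apply/funext => y; rewrite big_cons.
apply: is_derive_eq; first exact: (is_derive_mulr (hd i) (IH ur)).
rewrite big_cons big_cons eqxx; congr (_ + _).
  congr (_ * _); apply: eq_big_seq => j jr.
  by rewrite (negPf (memPn ir _ jr)).
rewrite mulr_sumr; apply: eq_big_seq => j jr.
by rewrite big_cons eq_sym (negPf (memPn ir _ jr)).
Qed.

(** Jacobi's formula.  Differentiating the Leibniz sum factor by factor replaces
one row of [M x] by the same row of [dM]; expanding each of these determinants
along the replaced row gives the cofactors of [M x]. *)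
Lemma is_derive_det m (M : V -> 'M[R]_m) x v dM :
  is_derive x v M dM ->
  is_derive x v (fun y => \det (M y)) (\tr (dM *m \adj (M x))).
Proof.
move=> /is_derive_mxP Md.
apply: is_derive_eq.
  apply: (@is_derive_bigsum _ _ _ _
    (fun (s : 'S_m) y => (-1) ^+ s * \prod_i M y i (s i))) => s _.
  apply: (is_derive_mulr (is_derive_cst ((-1) ^+ s : R) x v)).
  by apply: is_derive_bigprod; rewrite ?index_enum_uniq.
(* The determinant whose [i]-th row has been differentiated. *)
pose Mi i : 'M[R]_m := \matrix_(k, l) if k == i then dM k l else M x k l.
transitivity (\sum_i \det (Mi i)).
  rewrite /determinant exchange_big/=; apply: eq_bigr => s _.
  rewrite mul0r add0r /cst mulr_sumr.
  apply: eq_bigr => i _; congr (_ * _).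
  by apply: eq_bigr => k _; rewrite mxE.
rewrite /mxtrace; apply: eq_bigr => i _.
rewrite (expand_det_row _ i) mxE; apply: eq_bigr => j _.
rewrite !mxE eqxx; congr (_ * _); rewrite /cofactor; congr (_ * \det _).
by apply/matrixP => k l; rewrite !mxE eq_sym (negPf (neq_lift _ _)).
Qed.

(** Cofactors are signed determinants of minors.  Only differentiability of the
adjugate is recorded: it makes the inverse differentiable by Cramer's rule, and
the value of the derivative of the inverse is found more easily otherwise. *)
Lemma is_derive_adj m (M : V -> 'M[R]_m) x v dM :
  is_derive x v M dM -> derivable (fun y => \adj (M y)) x v.
Proof.
move=> /is_derive_mxP Md; apply/derivable_mxP => i j.
have minor_d : is_derive x v (fun y => row' j (col' i (M y)))
    (row' j (col' i (dM : 'M[R]_m))).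
  apply/is_derive_mxP => k l; rewrite !mxE.
  rewrite (_ : (fun y => _) = (fun y => M y (lift j k) (lift i l))) //.
  by apply/funext => y; rewrite !mxE.
rewrite (_ : (fun _ => _) =
    (fun y => (-1) ^+ (j + i) * \det (row' j (col' i (M y))))); last first.
  by apply/funext => y; rewrite !mxE.
apply: ex_derive.
exact: (is_derive_mulr (is_derive_cst ((-1) ^+ (j + i) : R) x v)
                       (is_derive_det minor_d)).
Qed.

(** The inverse is differentiable by Cramer's rule; its derivative is then read
off from the product rule applied to the constant [M y *m invmx (M y)]. *)
Lemma is_derive_invmx m (M : V -> 'M[R]_m) x v dM :
  (\forall y \near x, M y \in unitmx) -> is_derive x v M dM ->
  is_derive x v (fun y => invmx (M y)) (- (invmx (M x) *m dM *m invmx (M x))).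
Proof.
move=> Mu Md.
have Mxu : M x \in unitmx := nbhs_singleton Mu.
have invd : derivable (fun y => invmx (M y)) x v.
  apply: (@near_eq_derivable _ _ _ (fun y => (\det (M y))^-1 *: \adj (M y))).
    by near=> y; rewrite /invmx ifT//; near: y.
  apply/derivable_mxP => i j.
  rewrite (_ : (fun _ => _) = (fun y => (\det (M y))^-1 * \adj (M y) i j)).
    apply: ex_derive; apply: is_derive_mulr; apply: derivableP.
      apply: derivableV; first by rewrite -unitfE -unitmxE.
      by have [] := is_derive_det Md.
    by move/derivable_mxP: (is_derive_adj Md).
  by apply/funext => y; rewrite mxE.
have /derivableP := invd; set D := 'D_v _ _ => invD.
apply: is_derive_eq.
have : is_derive x v (fun y => M y *m invmx (M y)) 0.
  apply: (@near_eq_is_derive _ _ _ (cst 1%:M)).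
    by near=> y; rewrite mulmxV//; near: y.
(* [M * M^-1] is constant near [x], so its product-rule derivative is zero. *)
have := is_derive_mulmx Md invD.
move=> /@derive_val MD /@derive_val; rewrite {}MD => /eqP; rewrite addrC addr_eq0 => /eqP e.
by rewrite -mulmxA -mulmxN -e mulKmx.
Unshelve. all: by end_near. Qed.

Lemma is_derive_trmx p q (M : V -> 'M[R]_(p, q)) x v dM :
  is_derive x v M dM -> is_derive x v (fun y => (M y)^T) (dM^T).
Proof.
move=> /is_derive_mxP Md; apply/is_derive_mxP => i j; rewrite mxE.
by rewrite (_ : (fun y => _) = (fun y => M y j i))//; apply/funext => y; rewrite mxE.
Qed.

Lemma is_derive_mxtrace m (M : V -> 'M[R]_m) x v dM :
  is_derive x v M dM -> is_derive x v (fun y => \tr (M y)) (\tr dM).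
Proof.
by move=> /is_derive_mxP Md; apply: is_derive_bigsum => i _.
Qed.

End MatrixCalculus.

Lemma continuous_det (R : realType) (T : topologicalType) m (M : T -> 'M[R]_m) :
  (forall i j, continuous (fun y => M y i j)) -> continuous (fun y => \det (M y)).
Proof.
move=> Mc; apply: continuous_big => [|s _]; first exact: add_continuous.
move=> y; apply: cvgM; first exact: cvg_cst.
by apply: continuous_big => [|i _]; [exact: mul_continuous|exact: Mc].
Qed.

(** * The metric and its derivative *)

Section Gram.
Variable R : realType.

Lemma row_normsq_ge0 n (x : 'rV[R]_n) : 0 <= (x *m x^T) 0 0.
Proof. by rewrite mxE sumr_ge0// => i _; rewrite mxE -expr2 sqr_ge0. Qed.

Lemma row_normsq_eq0 n (x : 'rV[R]_n) : (x *m x^T) 0 0 = 0 -> x = 0.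
Proof.
rewrite mxE => /eqP; rewrite psumr_eq0 => [/allP x0|i _]; last first.
  by rewrite mxE -expr2 sqr_ge0.
apply/rowP => i; have := x0 i (mem_index_enum i).
by rewrite /= !mxE -expr2 sqrf_eq0 => /eqP.
Qed.

(** Along the segment from [M] to the identity all matrices are positive definite,
hence invertible, so the polynomial [det (M + t (1 - M))] has no root in
[[0, 1]]; it is 1 at [t = 1], so it cannot be nonpositive at [t = 0]. *)
Lemma posdef_det_gt0 m (M : 'M[R]_m) :
  (forall x : 'rV_m, x != 0 -> 0 < (x *m M *m x^T) 0 0) -> 0 < \det M.
Proof.
move=> Mpos; rewrite ltNge; apply/negP => detM.
pose P : 'M[{poly R}]_m := map_mx polyC M + 'X *: map_mx polyC (1%:M - M).
have PE t : (\det P).[t] = \det (M + t *: (1%:M - M)).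
  rewrite -[LHS]/(horner_eval t (\det P)) -det_map_mx; congr (\det _).
  apply/matrixP => i j.
  by rewrite !mxE /= /horner_eval !hornerE.
have [|t /andP[t0 t1]] := @poly_ivt R (\det P) 0 1 ler01.
  by rewrite !PE scale0r addr0 detM scale1r addrC subrK det1 ler01.
rewrite /root PE => /det0P[x x0 xN].
have e0 : (x *m M *m x^T) 0 0 + t * ((x *m x^T) 0 0 - (x *m M *m x^T) 0 0) = 0.
  transitivity ((x *m (M + t *: (1%:M - M)) *m x^T) 0 0).
    rewrite mulmxDr mulmxDl -scalemxAr -scalemxAl mulmxBr mulmx1 mulmxBl.
    by move: (_ *m _ *m x^T) (x *m x^T) => A B; rewrite !mxE.
  by rewrite xN mul0mx mxE.
have xMx := Mpos _ x0.
have xx : 0 < (x *m x^T) 0 0.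
  rewrite lt_neqAle row_normsq_ge0 andbT eq_sym.
  by apply: contra_neq x0; exact: row_normsq_eq0.
nra.
Qed.

Lemma gram_det_gt0 n m (a : 'M[R]_(n, m)) : \rank a = m -> 0 < \det (a^T *m a).
Proof.
move=> ra; apply: posdef_det_gt0 => x x0.
have -> : x *m (a^T *m a) *m x^T = x *m a^T *m (x *m a^T)^T.
  by rewrite trmx_mul trmxK !mulmxA.
rewrite lt_neqAle row_normsq_ge0 andbT eq_sym.
apply: contra_neq x0 => /row_normsq_eq0 xa0.
have aTfree : row_free a^T by rewrite /row_free mxrank_tr ra.
by apply/eqP; rewrite -(mulmx_free_eq0 x aTfree) xa0.
Qed.

Lemma gram_unitmx n m (a : 'M[R]_(n, m)) : \rank a = m -> a^T *m a \in unitmx.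
Proof. by move=> /gram_det_gt0 d0; rewrite unitmxE unitfE gt_eqF. Qed.

Lemma gram_tr n m (a : 'M[R]_(n, m)) : (invmx (a^T *m a))^T = invmx (a^T *m a).
Proof. by rewrite trmx_inv trmx_mul trmxK. Qed.

(** Needed because [invmx] agrees with Cramer's formula only on invertible
matrices. *)
Lemma near_gram_unitmx n m (a : 'M[R]_(n, m)) : \rank a = m ->
  \forall y \near a, y^T *m y \in unitmx.
Proof.
move=> /gram_det_gt0 d0.
have detc : continuous (fun y : 'M[R]_(n, m) => \det (y^T *m y)).
  apply: continuous_det => i j.
  rewrite (_ : (fun y => _) = (fun y : 'M[R]_(n, m) => \sum_k y k i * y k j)).
    apply: continuous_big => [|k _]; first exact: add_continuous.
    move=> y.
    by apply: (cvgM (@coord_continuous R n m k i y) (@coord_continuous R n m k j y)).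
  by apply/funext => y; rewrite mxE; apply: eq_bigr => k _; rewrite mxE.
have dnear := detc a _ (lt_nbhsr d0).
by near=> y; rewrite unitmxE unitfE gt_eqF//; near: y.
Unshelve. all: by end_near. Qed.

(** The derivative at [a], in the direction [w], of [a^T *m a]. *)
Definition dgram n m (a w : 'M[R]_(n, m)) := w^T *m a + a^T *m w.

Definition dmx_metric n m (a w u v : 'M[R]_(n, m)) : R :=
  let A := invmx (a^T *m a) in
  Num.sqrt (\det (a^T *m a)) *
    (\tr (dgram a w *m A) / 2 * \tr (u *m A *m v^T)
     - \tr (u *m (A *m dgram a w *m A) *m v^T)).

Lemma is_derive_mx_metric n m (a w u v : 'M[R]_(n, m)) : \rank a = m ->
  is_derive a w (fun y => mx_metric y u v) (dmx_metric a w u v).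
Proof.
move=> ra; have d0 := gram_det_gt0 ra.
have Gd : is_derive a w (fun y : 'M[R]_(n, m) => y^T *m y) (dgram a w).
  exact: (is_derive_mulmx (is_derive_trmx (is_derive_id a w)) (is_derive_id a w)).
have Ad := is_derive_invmx (near_gram_unitmx ra) Gd.
have td : is_derive a w (fun y => \tr (u *m invmx (y^T *m y) *m v^T))
    (- \tr (u *m (invmx (a^T *m a) *m dgram a w *m invmx (a^T *m a)) *m v^T)).
  apply: is_derive_eq.
    exact: (is_derive_mxtrace (is_derive_mulmx
      (is_derive_mulmx (is_derive_cst u a w) Ad) (is_derive_cst v^T a w))).
  by rewrite mulmx0 addr0 mul0mx add0r mulmxN mulNmx linearN.
have sd := @is_derive_comp_real _ _ Num.sqrt (fun y : 'M[R]_(n, m) => \det (y^T *m y))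
  _ _ _ _ (is_derive1_sqrt d0) (is_derive_det Gd).
apply: (is_derive_eq (is_derive_mulr td sd)).
have adjE : \adj (a^T *m a) = \det (a^T *m a) *: invmx (a^T *m a).
  by rewrite /invmx gram_unitmx// scalerA divff ?scale1r// gt_eqF.
rewrite adjE -scalemxAr linearZ/= /dmx_metric.
set s := Num.sqrt _; have s0 : s != 0 by rewrite gt_eqF// sqrtr_gt0.
have -> : \det (a^T *m a) = s ^+ 2 by rewrite sqr_sqrtr// ltW.
by field.
Qed.

End Gram.

(** * Totally geodesic linear subspaces *)

Section Criterion.
Variables (R : realType) (E : normedModType R).

(** The body of [levi_civita] for a single test vector [w], so that the test
vectors can be treated separately. *)
Definition koszul (g : metric E) (x u v z w : E) : Prop :=
  2 * g x z w = 'D_u (fun y => g y v w) x + 'D_v (fun y => g y u w) x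
    - 'D_w (fun y => g y u v) x.

(** The left inverse makes [phi] open onto its image: [phi @` O] is cut out of
[phi @` V] by the open set [psi @^-1` O]. *)
Lemma linear_parametrization d (V : set 'rV[R]_d)
    (phi : {linear 'rV[R]_d -> E}) (psi : {linear E -> 'rV[R]_d}) :
  continuous phi -> continuous psi -> cancel phi psi -> open V ->
  parametrization (phi @` V) V phi.
Proof.
move=> phic psic phiK Vo; split => //.
- exact: smooth_linear.
- by move=> x y _ _; exact: can_inj phiK _ _.
- by move=> x _ u v; rewrite !derive_linear//; exact: can_inj phiK _ _.
move=> O Oo OV; exists (psi @^-1` O).
  by apply: open_comp => // x _; exact: psic.
rewrite eqEsubset; split=> [_ [x Ox <-]|_ [[x Vx <-]]].
  by split; [exists x => //; exact: OV|rewrite /preimage/= phiK].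
by rewrite /preimage/= phiK => Ox; exists x.
Qed.

(** Derivatives commute with [phi], so the curve [c = phi \o x] satisfies
[c'' = phi x''], and the pulled-back metric has the same derivatives as [g] in the
directions [phi u].  The induced geodesic equation is thus Koszul's formula tested
against the range of [phi]; the last hypothesis extends it to all vectors. *)
Lemma totally_geodesic_linear (U : set E) (g : metric E) d (V : set 'rV[R]_d)
    (phi : {linear 'rV[R]_d -> E}) (psi : {linear E -> 'rV[R]_d}) :
  continuous phi -> continuous psi -> cancel phi psi -> open V ->
  phi @` V `<=` U ->
  (forall p u z, V p ->
     (forall w, koszul g (phi p) (phi u) (phi u) (phi z) (phi w)) ->
     forall w, koszul g (phi p) (phi u) (phi u) (phi z) w) ->
  totally_geodesic U g (phi @` V).
Proof.
move=> phic psic phiK Vo NU tangential.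
have par := linear_parametrization phic psic phiK Vo.
split=> //; first by exists d => p Np; exists V, phi.
move=> I c [Io Iitv Ic loc].
have cE t : I t -> V (psi (c t)) /\ phi (psi (c t)) = c t.
  by move=> /Ic[[x Vx <-] _]; rewrite phiK.
have [_ _ geo] := loc d V phi par I (psi \o c) Io Iitv (fun _ => id) cE.
set x := psi \o c in geo.
have near_I t : I t -> \forall s \near t, I s by move=> It; exact: open_nbhs_nbhs.
have cd t : I t -> is_derive t 1 c (phi (derive1 x t)).
  move=> It; have [_ xd _ _] := geo t It.
  apply: (@near_eq_is_derive _ _ _ (phi \o x)).
    by apply: filterS (near_I t It) => s /cE[].
  have := derivableP xd; rewrite -derive1E => xd'.
  exact: (is_derive_linear_comp phic xd').
have c'E t : I t -> derive1 c t = phi (derive1 x t).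
  by move=> /cd cdt; rewrite derive1E derive_val.
have cdd t : I t -> is_derive t 1 (derive1 c) (phi (derive1 (derive1 x) t)).
  move=> It; have [_ _ xdd _] := geo t It.
  apply: (@near_eq_is_derive _ _ _ (phi \o derive1 x)).
    by apply: filterS (near_I t It) => s Is; rewrite c'E.
  have := derivableP xdd; rewrite -derive1E => xdd'.
  exact: (is_derive_linear_comp phic xdd').
split=> // t It; have [Vx _ _ lc] := geo t It.
have [_ cEt] := cE t It.
split.
- by apply: NU; exists (x t).
- by case: (cd t It).
- by case: (cdd t It).
have c''E : derive1 (derive1 c) t = phi (derive1 (derive1 x) t).
  by rewrite [LHS]derive1E; case: (cdd t It).
rewrite c'E// c''E -linearN -cEt; apply: tangential => // w.
have pullbackE v v' : (fun y => pullback phi g y v v') =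
    (fun y => g y (phi v) (phi v')) \o phi.
  by apply/funext => y; rewrite /pullback !derive_linear.
have := lc w; rewrite !pullbackE !derive_comp_linear.
by rewrite /pullback !derive_linear.
Qed.

End Criterion.

Section MatrixCriterion.
Variables (R : realType) (n m : nat).
Implicit Types a u v w z : 'M[R]_(n, m).

(** The traces that occur in Koszul's formula at [a] for [u], [u] and [z], tested
against [w]: the metric terms, and the derivatives of the metric along [u] and
along [w].  The first two say that [w] is orthogonal to [z] and [u]. *)
Definition metric_normal a u z w : Prop :=
  let A := invmx (a^T *m a) in
  [/\ \tr (z *m A *m w^T) = 0, \tr (u *m A *m w^T) = 0,
      \tr (u *m (A *m dgram a u *m A) *m w^T) = 0,
      \tr (dgram a w *m A) = 0 &
      \tr (u *m (A *m dgram a w *m A) *m u^T) = 0].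

Lemma derive_mx_metric a w u v : \rank a = m ->
  'D_w (fun y => mx_metric y u v) a = dmx_metric a w u v.
Proof. by move=> ra; have [_ ->] := is_derive_mx_metric w u v ra. Qed.

Lemma koszul_normal a u z w : \rank a = m -> metric_normal a u z w ->
  koszul (@mx_metric R n m) a u u z w.
Proof.
move=> ra [zw uw uuw aw uwu]; rewrite /koszul.
rewrite !derive_mx_metric// /dmx_metric /mx_metric zw uw uuw aw uwu.
by rewrite !(mul0r, mulr0, subrr, addr0).
Qed.

Lemma koszulD a u z w1 w2 : \rank a = m ->
  koszul (@mx_metric R n m) a u u z w1 -> koszul (@mx_metric R n m) a u u z w2 ->
  koszul (@mx_metric R n m) a u u z (w1 + w2).
Proof.
move=> ra; rewrite /koszul.
rewrite !derive_mx_metric// /dmx_metric /mx_metric.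
have -> : dgram a (w1 + w2) = dgram a w1 + dgram a w2.
  by rewrite /dgram linearD/= mulmxDl mulmxDr addrACA.
rewrite !linearD/= !(mulmxDr, mulmxDl) !linearD/=.
by move=> *; lra.
Qed.

Lemma mx_totally_geodesic_linear d (V : set 'rV[R]_d)
    (phi : {linear 'rV[R]_d -> 'M[R]_(n, m)}) (psi : {linear 'M[R]_(n, m) -> 'rV[R]_d}) :
  cancel phi psi -> open V -> phi @` V `<=` @Mplus R n m ->
  (forall (p u z : 'rV[R]_d) w, V p -> exists q,
     metric_normal (phi p) (phi u) (phi z) (w - phi q)) ->
  totally_geodesic (@Mplus R n m) (@mx_metric R n m) (phi @` V).
Proof.
move=> phiK Vo NM split_w.
apply: (totally_geodesic_linear (psi := psi)) => //.
- exact: mx_linear_continuous.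
- exact: mx_linear_continuous.
move=> p u z Vp tangent w.
have rp : \rank (phi p) = m by apply: NM; exists p.
have [q wq] := split_w p u z w Vp.
by rewrite -(subrK (phi q) w); apply: koszulD => //; exact: koszul_normal.
Qed.

End MatrixCriterion.

(** * Invertible matrices and rays *)

Section Frames.
Variables (R : realType) (n m : nat).

Lemma open_unitmx_row : open [set x : 'rV[R]_(m * m) | vec_mx x \in unitmx].
Proof.
rewrite (_ : mkset _ =
    (fun x : 'rV[R]_(m * m) => \det (vec_mx x)) @^-1` [set r | r != 0]).
  apply: open_comp; last exact: open_neq.
  move=> x _; apply: continuous_det => i j.
  rewrite (_ : (fun y => _) = (fun y : 'rV_(m * m) => y ord0 (mxvec_index i j))).
    exact: coord_continuous.
  by apply/funext => y; rewrite mxE.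
by apply/seteqP; split => x /=; rewrite unitmxE unitfE.
Qed.

(** The rest [w' = w - J J^T w] of a vector is orthogonal to the columns of [J], so
that the Gram matrix of [J c + t w'] is even in [t] and every term of Koszul's
formula tested against [w'] is zero. *)
Lemma totally_geodesic_frame_GL (J : 'M[R]_(n, m)) : J^T *m J = 1%:M ->
  totally_geodesic (@Mplus R n m) (@mx_metric R n m)
    [set J *m c | c in [set c : 'M[R]_m | c \in unitmx]].
Proof.
move=> JJ; set N := (X in totally_geodesic _ _ X).
pose phi : {linear 'rV[R]_(m * m) -> 'M[R]_(n, m)} := mulmx J \o vec_mx.
pose psi : {linear 'M[R]_(n, m) -> 'rV[R]_(m * m)} := mxvec \o mulmx J^T.
have NE : N = phi @` [set x | vec_mx x \in unitmx].
  apply/seteqP; split => _ [c /= cu <-]; last by exists (vec_mx c).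
  by exists (mxvec c) => /=; rewrite mxvecK.
rewrite NE; apply: (mx_totally_geodesic_linear (psi := psi)).
- by move=> x /=; rewrite mulmxA JJ mul1mx vec_mxK.
- exact: open_unitmx_row.
- move=> _ [x /= xu <-]; apply/eqP; rewrite eqn_leq rank_leq_col/=.
  rewrite -[leqLHS](mxrank_unit xu) -[X in (\rank X <= _)%N]mul1mx -JJ -mulmxA.
  exact: mxrankM_maxr.
move=> p u z w _; exists (mxvec (J^T *m w)) => /=; rewrite mxvecK.
set w' := w - _.
have Jw : J^T *m w' = 0 by rewrite mulmxBr mulmxA JJ mul1mx subrr.
have wJ : w'^T *m J = 0 by rewrite -[J]trmxK -trmx_mul Jw trmx0.
have dw c : dgram (J *m c) w' = 0.
  by rewrite /dgram mulmxA wJ mul0mx trmx_mul -mulmxA Jw mulmx0 addr0.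
have tw c D : \tr (J *m c *m D *m w'^T) = 0.
  by rewrite mxtrace_mulC !mulmxA wJ !mul0mx linear0.
by split; rewrite ?tw ?dw ?mulmx0 ?mul0mx ?mulmx0 ?mul0mx ?linear0.
Qed.

(** Every matrix is, up to a multiple of [b], a [w'] with
[tr (b (b^T b)^-1 w'^T) = 0].  At [a = l b] the Gram matrix is [l^2 b^T b], so
[A], [dgram a u] and the products [A (dgram a u) A] are multiples of [(b^T b)^-1]
or of [b^T b], and all the identities of [metric_normal] follow from that one. *)
Lemma totally_geodesic_Scal (b : 'M[R]_(n, m)) : (0 < m)%N -> Mplus b ->
  totally_geodesic (@Mplus R n m) (@mx_metric R n m) (Scal b).
Proof.
rewrite /Mplus/= => m0 rb.
have b0 : mxvec b != 0.
  by rewrite mxvec_eq0; apply: contra_eq_neq rb => ->; rewrite mxrank0 ltn_eqF.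
have bfree : row_free (mxvec b) by rewrite /row_free rank_rV b0.
pose phi : {linear 'rV[R]_1 -> 'M[R]_(n, m)} := vec_mx \o mulmxr (mxvec b).
pose psi : {linear 'M[R]_(n, m) -> 'rV[R]_1} := mulmxr (pinvmx (mxvec b)) \o mxvec.
have phiE x : phi x = x 0 0 *: b.
  by rewrite /= [x]mx11_scalar mul_scalar_mx linearZ/= mxvecK mxE eqxx mulr1n.
have ScalE : Scal b = phi @` [set x : 'rV[R]_1 | 0 < x 0 0].
  apply/seteqP; split => _ [c /= c0 <-].
    exists c%:M; first by rewrite /= mxE eqxx mulr1n.
    by rewrite -[LHS]/(phi c%:M) phiE mxE eqxx mulr1n.
  by exists (c 0 0) => //; rewrite -[RHS]/(phi c) phiE.
rewrite ScalE; apply: (mx_totally_geodesic_linear (psi := psi)).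
- by move=> x /=; rewrite vec_mxK -mulmxA mulmxVp// mulmx1.
- have := open_comp (D := [set r : R | 0 < r]) (f := fun x : 'rV[R]_1 => x 0 0).
  by apply=> [x _|]; [exact: coord_continuous|exact: open_gt].
- move=> _ [x /= x0 <-]; suff: Mplus (phi x) by [].
  by rewrite phiE /Mplus/= mxrank_scale_nz ?gt_eqF.
move=> p u z w p0; set B := b^T *m b; set A := invmx B.
have Bu : B \in unitmx := gram_unitmx rb.
exists (\tr (b *m A *m w^T) / m%:R)%:M.
rewrite !(phiE p, phiE u, phiE z) phiE [_%:M 0 0]mxE eqxx mulr1n.
have {p0} : 0 < p 0 0 := p0.
move: (p 0 0) (u 0 0) (z 0 0) => l r s l0.
(* The coefficient of [b] above makes the rest orthogonal to [b]. *)
set w' := w - _.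
have bw : \tr (b *m A *m w'^T) = 0.
  rewrite linearB/= linearZ/= mulmxBr linearB/= -scalemxAr linearZ/=.
  have -> : \tr (b *m A *m b^T) = m%:R.
    by rewrite mxtrace_mulC mulmxA mulmxV ?mxtrace1.
  by rewrite divfK ?subrr// pnatr_eq0 -lt0n.
have wb : \tr (w'^T *m b *m A) = 0 by rewrite -mulmxA mxtrace_mulC.
have wb' : \tr (b^T *m w' *m A) = 0.
  rewrite -mxtrace_tr !trmx_mul gram_tr trmxK mxtrace_mulC.
  by rewrite wb.
have ZT c (d : 'M[R]_(n, m)) : (c *: d)^T = c *: d^T by rewrite linearZ.
have AE : invmx ((l *: b)^T *m (l *: b)) = l ^- 2 *: A.
  rewrite ZT -scalemxAl -scalemxAr scalerA -expr2.
  by rewrite invmxZ// unitmxZ// unitfE expf_neq0 ?gt_eqF.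
have dw : \tr (dgram (l *: b) w' *m A) = 0.
  rewrite /dgram ZT -scalemxAr -scalemxAl mulmxDl -!scalemxAl linearD/=.
  by rewrite !mxtraceZ wb wb' !mulr0 addr0.
have du : dgram (l *: b) (r *: b) = (l * r *+ 2) *: B.
  rewrite /dgram !ZT -!(scalemxAl, scalemxAr) !scalerA -scalerDl.
  by rewrite mulr2n [r * l]mulrC.
rewrite /metric_normal AE; split.
- by rewrite -!scalemxAl -!scalemxAr -!scalemxAl !mxtraceZ bw !mulr0.
- by rewrite -!scalemxAl -!scalemxAr -!scalemxAl !mxtraceZ bw !mulr0.
- rewrite du -!(scalemxAl, scalemxAr) mulVmx// mul1mx.
  by rewrite !mxtraceZ bw !mulr0.
- by rewrite -scalemxAr mxtraceZ dw mulr0.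
rewrite ZT -!(scalemxAl, scalemxAr) !mxtraceZ.
have -> : \tr (b *m (A *m dgram (l *: b) w' *m A) *m b^T) = 0.
  rewrite mxtrace_mulC !mulmxA -/B mulmxV// mul1mx.
  exact: dw.
by rewrite !mulr0.
Qed.

Lemma extend0E (hmn : (m <= n)%N) (c : 'M[R]_m) :
  extend0 hmn c = extend0 hmn 1%:M *m c.
Proof.
rewrite /extend0; move: (subnKC hmn); move: (n - m)%N => k e.
case: n / e {hmn}; rewrite !castmx_id.
by rewrite mul_col_mx mul1mx mul0mx.
Qed.

Lemma extend0_isometry (hmn : (m <= n)%N) :
  (extend0 hmn (1%:M : 'M[R]_m))^T *m extend0 hmn 1%:M = 1%:M.
Proof.
rewrite /extend0; move: (subnKC hmn); move: (n - m)%N => k e.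
case: n / e {hmn}; rewrite !castmx_id.
by rewrite tr_col_mx mul_row_col trmx0 mul0mx addr0 trmx1 mul1mx.
Qed.

End Frames.

Theorem theorem3p8 (R : realType) (n m : nat) (hmn : (m <= n)%N) :
  (forall b : 'M[R]_(n, m), Mplus b ->
     totally_geodesic (@Mplus R n m) (@mx_metric R n m) (Scal b)) /\
  totally_geodesic (@Mplus R n m) (@mx_metric R n m) (GLm hmn).
Proof.
have GL : totally_geodesic (@Mplus R n m) (@mx_metric R n m) (GLm hmn).
  rewrite (_ : GLm hmn = [set extend0 hmn 1%:M *m c | c in [set c | c \in unitmx]]).
    exact/totally_geodesic_frame_GL/extend0_isometry.
  by apply: eq_imagel => c _; rewrite extend0E.
split=> // b rb; have [m0|m0] := posnP m; last exact: totally_geodesic_Scal.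
(* Without columns there is a single matrix, and both sets contain it. *)
suff -> : Scal b = GLm hmn by [].
have triv (x y : 'M[R]_(n, m)) : x = y.
  by apply/matrixP => i [j jm]; exfalso; move: jm; rewrite m0.
apply/seteqP; split => x _.
  by exists 1%:M; [exact: unitmx1|exact: triv].
by exists 1; [exact: ltr01|exact: triv].
Qed.
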